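(* Let $S$ be a $\mathrm{Cu}$-semigroup. Then a submonoid $T\subseteq S$ is a sub-$\mathrm{Cu}$-semigroup if and only if $T=T'$.
   Context: Way-below relation: in a partially ordered set, $x\ll y$ means that for every increasing sequence $(z_n)_n$ that has a supremum $z$ with $y\leq z$ there exists $n$ with $x\leq z_n$. A $\mathrm{Cu}$-semigroup is an abelian monoid $S$ with a partial order such that $0\leq x$ for all $x$, and $x\leq y$ implies $x+z\leq y+z$, satisfying: (O1) every increasing sequence has a supremum; (O2) every element is the supremum of a $\ll$-increasing sequence (i.e. $x_n\ll x_{n+1}$ for all $n$); (O3) $x'\ll x$ and $y'\ll y$ imply $x'+y'\ll x+y$; (O4) $\sup_n x_n+\sup_n y_n=\sup_n(x_n+y_n)$ for increasing sequences $(x_n)_n,(y_n)_n$. A $\mathrm{Cu}$-morphism is an order-preserving monoid morphism between $\mathrm{Cu}$-semigroups that preserves suprema of increasing sequences and the way-below relation. A submonoid $T\subseteq S$ is a sub-$\mathrm{Cu}$-semigroup if $T$ is a $\mathrm{Cu}$-semigroup with respect to the order induced by $S$ and the inclusion map $T\to S$ is a $\mathrm{Cu}$-morphism. For a subset $T\subseteq S$, set $T':=\{\sup_n x_n\in S : (x_n)_n \text{ is a } \ll\text{-increasing sequence in } T\}$, where $\ll$ and the supremum are taken in $S$. *)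

(* Defs.v *)
From HB Require Import structures.
From mathcomp Require Import all_boot all_order.
From mathcomp Require Import boolp classical_sets.

Set Implicit Arguments.
Unset Strict Implicit.
Unset Printing Implicit Defensive.

Import Order.TTheory.

Local Open Scope classical_set_scope.
Local Open Scope order_scope.

Section WayBelow.
Context {d : Order.disp_t} {S : porderType d}.

Definition increasing_seq (u : nat -> S) : Prop :=
  {homo u : m n / (m <= n)%N >-> m <= n}.

Definition is_sup_seq (u : nat -> S) (s : S) : Prop := supremums (range u) s.

Definition way_below (x y : S) : Prop :=
  forall (u : nat -> S) (s : S),
    increasing_seq u -> is_sup_seq u s -> y <= s -> exists n, x <= u n.

Definition way_below_increasing (u : nat -> S) : Prop :=
  forall n, way_below (u n) (u n.+1).

(* T' *)
Definition way_below_sups (T : set S) : set S :=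
  [set x | exists u : nat -> S,
    [/\ forall n, T (u n), way_below_increasing u & is_sup_seq u x]].

End WayBelow.

(* An ordered abelian monoid is a [porderType] together with a commutative
   monoid law: MathComp's additive and order hierarchies have no join below
   ordered groups. *)
Record is_Cu_semigroup d (S : porderType d) (zero : S)
    (add : Monoid.com_law zero) : Prop := IsCuSemigroup {
  Cu_ge0 : forall x : S, zero <= x;
  Cu_leD : forall x y z : S, x <= y -> add x z <= add y z;
  Cu_O1 : forall u : nat -> S, increasing_seq u -> exists s, is_sup_seq u s;
  Cu_O2 : forall x : S,
    exists u : nat -> S, way_below_increasing u /\ is_sup_seq u x;
  Cu_O3 : forall x' x y' y : S,
    way_below x' x -> way_below y' y -> way_below (add x' y') (add x y);
  Cu_O4 : forall (u v : nat -> S) (s t : S),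
    increasing_seq u -> increasing_seq v ->
    is_sup_seq u s -> is_sup_seq v t ->
    is_sup_seq (fun n => add (u n) (v n)) (add s t)
}.

(* The conditions on a map; that its source and target are Cu-semigroups is
   required separately. *)
Record is_Cu_morphism d (S : porderType d) (zeroS : S)
    (addS : Monoid.com_law zeroS) d' (R : porderType d') (zeroR : R)
    (addR : Monoid.com_law zeroR) (f : S -> R) : Prop := IsCuMorphism {
  Cu_morph0 : f zeroS = zeroR;
  Cu_morphD : {morph f : x y / addS x y >-> addR x y};
  Cu_morph_le : {homo f : x y / x <= y};
  Cu_morph_sup : forall (u : nat -> S) (s : S),
    increasing_seq u -> is_sup_seq u s -> is_sup_seq (f \o u) (f s);
  Cu_morph_way_below : forall x y : S, way_below x y -> way_below (f x) (f y)
}.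

Record submonoid d (S : porderType d) (zero : S) (add : Monoid.com_law zero) :=
  Submonoid {
  submonoid_set :> set S;
  submonoid0 : submonoid_set zero;
  submonoidD : forall x y,
    submonoid_set x -> submonoid_set y -> submonoid_set (add x y)
}.

Section SubmonoidType.
Context {d : Order.disp_t} {S : porderType d} {zero : S}
  {add : Monoid.com_law zero}.
Variable T : submonoid add.

Definition submonoid_type : Type := set_type T.

HB.instance Definition _ := SubChoice.on submonoid_type.
(* the order induced by S *)
HB.instance Definition _ := [SubChoice_isSubPOrder of submonoid_type by <: with d].

Definition sub_zero : submonoid_type := Sub zero (mem_set (submonoid0 T)).

Definition sub_add (x y : submonoid_type) : submonoid_type :=
  Sub (add (val x) (val y))
    (mem_set (submonoidD (set_mem (valP x)) (set_mem (valP y)))).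

Lemma sub_addA : associative sub_add.
Proof. by move=> x y z; apply: val_inj; rewrite !SubK Monoid.mulmA. Qed.

Lemma sub_addC : commutative sub_add.
Proof. by move=> x y; apply: val_inj; rewrite !SubK Monoid.mulmC. Qed.

Lemma sub_add0 : left_id sub_zero sub_add.
Proof. by move=> x; apply: val_inj; rewrite !SubK Monoid.mul1m. Qed.

HB.instance Definition _ :=
  Monoid.isComLaw.Build submonoid_type sub_zero sub_add
    sub_addA sub_addC sub_add0.

Definition is_sub_Cu_semigroup : Prop :=
  is_Cu_semigroup sub_add /\ is_Cu_morphism sub_add add (val : submonoid_type -> S).

End SubmonoidType.

(* Main.v *)
Require Import Defs.
From mathcomp Require Import all_boot all_order.
From mathcomp Require Import boolp classical_sets.

(** The forward implication is formal: the inclusion of a sub-Cu-semigroup [T]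
preserves both suprema and the way-below relation, so the approximating
sequences that (O2) provides inside [T] show [T `<=` T'], and a way-below
increasing sequence of [T] has by (O1) a supremum in [T], which is also its
supremum in the ambient semigroup, so [T' `<=` T].

For the converse, the point is that [T = T'], a condition on way-below
increasing sequences, already forces [T] to be closed under suprema of all
increasing sequences ([sup_closed_of_way_below_sups]).  Approximate each term
of such a sequence by a way-below increasing sequence of [T]; a diagonal
through this double sequence can be chosen way-below increasing, with the same
supremum ([way_below_diagonal]).  Closure under suprema means that suprema of
increasing sequences are the same in [T] and in the ambient semigroup
([is_sup_seq_val]), and then the way-below relations agree as well
([way_below_val]): if [x] is way below [y] in [T], approximate [y] by a
way-below increasing sequence of [T]; then [x] lies below one of its terms,
which is way below [y] in the ambient semigroup.  Once suprema and the
way-below relation agree, each axiom passes from the ambient semigroup to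
[T]. *)

Set Implicit Arguments.
Unset Strict Implicit.
Unset Printing Implicit Defensive.

Import Order.TTheory.

Local Open Scope classical_set_scope.
Local Open Scope order_scope.

(** * Suprema and the way-below relation in a partial order *)

Section WayBelowTheory.
Context {d : Order.disp_t} {S : porderType d}.
Implicit Types (x y z s : S) (u : nat -> S).

Lemma is_sup_seqP u s : is_sup_seq u s <->
  (forall n, u n <= s) /\ (forall b, (forall n, u n <= b) -> s <= b).
Proof.
split=> [[ubs lubs]|[ubs lubs]]; split.
- by move=> n; apply: ubs; exists n.
- by move=> b ubb; apply: lubs => _ [n _ <-].
- by move=> _ [n _ <-].
- by move=> b ubb; apply: lubs => n; apply: ubb; exists n.
Qed.

Lemma is_sup_seq_uniq u s t : is_sup_seq u s -> is_sup_seq u t -> s = t.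
Proof.
move=> /is_sup_seqP[us sl] /is_sup_seqP[ut tl].
by apply/le_anti; rewrite sl //= tl.
Qed.

Lemma increasing_seqS u : (forall n, u n <= u n.+1) -> increasing_seq u.
Proof. by move=> uS; apply: homo_leq => //; apply: le_trans. Qed.

Lemma way_below_le x y : way_below x y -> x <= y.
Proof.
move=> /(_ (fun=> y) y) [] //; apply/is_sup_seqP.
by split=> // b /(_ 0).
Qed.

Lemma way_below_le_trans y x z : way_below x y -> y <= z -> way_below x z.
Proof. by move=> xy yz u s incu us zs; apply: xy us (le_trans yz zs). Qed.

Lemma le_way_below_trans y x z : x <= y -> way_below y z -> way_below x z.
Proof.
move=> xy yz u s incu us zs; have [n yn] := yz u s incu us zs.
by exists n; apply: le_trans yn.
Qed.

Lemma way_below_increasingW u : way_below_increasing u -> increasing_seq u.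
Proof. by move=> wu; apply: increasing_seqS => n; apply: way_below_le. Qed.

Lemma way_below_increasing_sup u s n :
  way_below_increasing u -> is_sup_seq u s -> way_below (u n) s.
Proof. by move=> wu /is_sup_seqP[us _]; apply: way_below_le_trans (us _). Qed.

(** Monotonicity of the sequence turns finitely many bounds by its terms into
bounds by a single term. *)
Lemma increasing_common_bound u (a : nat -> S) m : increasing_seq u ->
  (forall i, (i < m)%N -> exists k, a i <= u k) ->
  exists k, forall i, (i < m)%N -> a i <= u k.
Proof.
move=> incu; elim: m => [|m IHm] au; first by exists 0%N.
have [k ak] : exists k, forall i, (i < m)%N -> a i <= u k.
  by apply: IHm => i im; apply/au/ltnW.
have [l al] := au m (ltnSn m).
exists (maxn k l) => i; rewrite ltnS leq_eqVlt => /predU1P[->|im].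
  by apply: le_trans al _; apply: incu; apply: leq_maxr.
by apply: le_trans (ak i im) _; apply: incu; apply: leq_maxl.
Qed.

(** The index [k n.+1] is chosen so that the new diagonal term is way above the
previous one and dominates the terms [x i n], [i <= n]: all of these are way
below [s n.+1], hence below some term of row [n.+1].  The second requirement
makes the diagonal dominate the whole double sequence. *)
Lemma way_below_diagonal (x : nat -> nat -> S) (s : nat -> S) t :
  (forall n, way_below_increasing (x n)) ->
  (forall n, is_sup_seq (x n) (s n)) ->
  increasing_seq s -> is_sup_seq s t ->
  exists k : nat -> nat,
    way_below_increasing (fun n => x n (k n)) /\
    is_sup_seq (fun n => x n (k n)) t.
Proof.
move=> wx xs incs /is_sup_seqP[st tl].
have incx n : increasing_seq (x n) by apply: way_below_increasingW.
have xle n i j : (i <= n)%N -> exists k, x i j <= x n k.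
  move=> le_in; have xi := way_below_increasing_sup j (wx i) (xs i).
  exact: xi (incx n) (xs n) (incs _ _ le_in).
have next n k : exists k', way_below (x n k) (x n.+1 k') /\
    forall i, (i < n.+1)%N -> x i n <= x n.+1 k'.
  have [k1 xk1] := xle n.+1 n k (leqnSn n).
  have [|k2 xk2] := increasing_common_bound (a := x^~ n) (m := n.+1) (incx n.+1).
    by move=> i lt_in; apply: xle; apply: ltnW.
  exists (maxn k1 k2).+1; split=> [|i lt_in].
    apply: le_way_below_trans (wx _ _); apply: le_trans xk1 _.
    by apply: incx; apply: leq_maxl.
  apply: le_trans (xk2 i lt_in) _.
  by apply: incx; apply: leqW; apply: leq_maxr.
have /choice[f fP] : forall nk, exists k',
    way_below (x nk.1 nk.2) (x nk.1.+1 k') /\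
    forall i, (i < nk.1.+1)%N -> x i nk.1 <= x nk.1.+1 k'.
  by case=> n k; apply: next.
pose k := nat_rect (fun=> nat) 0%N (fun n kn => f (n, kn)).
exists k; split=> [n|]; first by have [] := fP (n, k n).
apply/is_sup_seqP; split=> [n|b kb].
  by apply: le_trans (st n); have /is_sup_seqP[] := xs n.
apply: tl => i; have /is_sup_seqP[_] := xs i; apply=> j.
pose n := maxn i j.
have xin : x i n <= x n.+1 (k n.+1).
  by have [_] := fP (n, k n); apply; rewrite ltnS leq_maxl.
apply: le_trans (le_trans xin (kb n.+1)).
by apply: incx; apply: leq_maxr.
Qed.

Lemma sup_closed_of_way_below_sups (A : set S) : A = way_below_sups A ->
  forall u s, (forall n, A (u n)) -> increasing_seq u -> is_sup_seq u s -> A s.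
Proof.
move=> AA' u s Au incu us.
have /choice[x xP] n : exists v : nat -> S,
    [/\ forall m, A (v m), way_below_increasing v & is_sup_seq v (u n)].
  by have := Au n; rewrite {1}AA'.
have [| |k [wk ks]] := way_below_diagonal (x := x) _ _ incu us.
- by move=> n; case: (xP n).
- by move=> n; case: (xP n).
by rewrite AA'; exists (fun n => x n (k n)); split=> // n; case: (xP n).
Qed.

End WayBelowTheory.

(** * Comparing a submonoid with the ambient semigroup *)

Section SubmonoidComparison.
Context {d : Order.disp_t} {S : porderType d} {zero : S}
  {add : Monoid.com_law zero}.
Variable T : submonoid add.
Implicit Types (x y s : submonoid_type T) (u : nat -> submonoid_type T).

Lemma val_le x y : (val x <= val y) = (x <= y).
Proof. by []. Qed.

Lemma submonoid_val x : submonoid_set T (val x).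
Proof. exact: set_mem (valP x). Qed.

Lemma submonoid_lift (a : S) : submonoid_set T a -> exists x, val x = a.
Proof. by move=> Ta; exists (Sub a (mem_set Ta)); rewrite SubK. Qed.

Lemma submonoid_lift_seq (v : nat -> S) :
  (forall n, submonoid_set T (v n)) -> exists u, val \o u = v.
Proof.
move=> Tv; have /choice[u uv] n := submonoid_lift (Tv n).
by exists u; apply/funext.
Qed.

Lemma increasing_seq_val u : increasing_seq (val \o u) <-> increasing_seq u.
Proof. by split=> incu m n /incu; rewrite /= val_le. Qed.

(** The least upper bound property in [T] is tested on fewer elements than in
the ambient order, so this direction holds for every submonoid. *)
Lemma is_sup_seq_of_val u s : is_sup_seq (val \o u) (val s) -> is_sup_seq u s.
Proof.
move=> /is_sup_seqP[us sl]; apply/is_sup_seqP; split=> [n|b ub].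
  by rewrite -val_le us.
by rewrite -val_le; apply: sl => n; rewrite /= val_le.
Qed.

Lemma sub_Cu_eq_way_below_sups :
  is_sub_Cu_semigroup T -> submonoid_set T = way_below_sups (submonoid_set T).
Proof.
move=> [hT hval]; apply/seteqP; split=> a.
  move=> /submonoid_lift[x <-]; have [u [wu ux]] := Cu_O2 hT x.
  exists (val \o u); split=> [n|n|].
  - exact: submonoid_val.
  - exact: (Cu_morph_way_below hval (wu n)).
  - exact: (Cu_morph_sup hval (way_below_increasingW wu) ux).
move=> [v [/submonoid_lift_seq[u <-] wu ua]].
have incu : increasing_seq u by apply: (increasing_seq_val u).1 (way_below_increasingW wu).
have [s us] := Cu_O1 hT incu.
rewrite (is_sup_seq_uniq ua (Cu_morph_sup hval incu us)).
exact: submonoid_val.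
Qed.

Section Closed.
Hypothesis hS : is_Cu_semigroup add.
Hypothesis TT' : submonoid_set T = way_below_sups (submonoid_set T).

Lemma submonoid_O1 u : increasing_seq u ->
  exists s, is_sup_seq (val \o u) (val s).
Proof.
move=> /(increasing_seq_val u).2 incu; have [a ua] := Cu_O1 hS incu.
have /submonoid_lift[s sa] : submonoid_set T a.
  by apply: sup_closed_of_way_below_sups TT' _ _ _ incu ua => n;
     apply: submonoid_val.
by exists s; rewrite sa.
Qed.

Lemma is_sup_seq_val u s : increasing_seq u ->
  is_sup_seq (val \o u) (val s) <-> is_sup_seq u s.
Proof.
move=> incu; split=> [|us]; first exact: is_sup_seq_of_val.
have [t ut] := submonoid_O1 incu.
by rewrite (is_sup_seq_uniq us (is_sup_seq_of_val ut)).
Qed.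

Lemma submonoid_approx y : exists u,
  way_below_increasing (val \o u) /\ is_sup_seq (val \o u) (val y).
Proof.
have : way_below_sups (submonoid_set T) (val y).
  by rewrite -TT'; apply: submonoid_val.
move=> [v [/submonoid_lift_seq[u <-] wu uy]].
by exists u.
Qed.

(** From right to left, approximating [y] inside [T] replaces the sequences of
the ambient semigroup, of which the hypothesis says nothing, by a single
sequence of [T]. *)
Lemma way_below_val x y : way_below (val x) (val y) <-> way_below x y.
Proof.
split=> xy.
  move=> u s incu us ys.
  have [||n xn] := xy (val \o u) (val s) _ _ ys.
  - exact: (increasing_seq_val u).2.
  - exact/is_sup_seq_val.
  by exists n; rewrite -val_le.
have [u [wu uy]] := submonoid_approx y.
have [||n xn] := xy u y _ _ (lexx y).
- exact: (increasing_seq_val u).1 (way_below_increasingW wu).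
- exact: is_sup_seq_of_val.
rewrite -val_le in xn.
exact: le_way_below_trans xn (way_below_increasing_sup n wu uy).
Qed.

Lemma way_below_sups_eq_sub_Cu : is_sub_Cu_semigroup T.
Proof.
split; split.
- by move=> x; rewrite -val_le SubK; apply: Cu_ge0 hS _.
- by move=> x y z xy; rewrite -val_le !SubK; apply: Cu_leD hS _ _ _ _;
     rewrite val_le.
- move=> u /submonoid_O1[s us]; exists s; exact: is_sup_seq_of_val.
- move=> x; have [u [wu ux]] := submonoid_approx x.
  exists u; split=> [n|]; last exact: is_sup_seq_of_val.
  exact/way_below_val/wu.
- move=> x' x y' y /way_below_val xx /way_below_val yy; apply/way_below_val.
  by rewrite !SubK; apply: Cu_O3 hS _ _ _ _ xx yy.
- move=> u v s t incu incv /(is_sup_seq_val _ incu) us /(is_sup_seq_val _ incv) vt.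
  apply: is_sup_seq_of_val.
  exact: Cu_O4 hS _ _ _ _ ((increasing_seq_val u).2 incu)
    ((increasing_seq_val v).2 incv) us vt.
- by [].
- by [].
- by move=> x y; rewrite val_le.
- by move=> u s incu /(is_sup_seq_val _ incu).
- by move=> x y /way_below_val.
Qed.

End Closed.

End SubmonoidComparison.

Theorem proposition4p11 (d : Order.disp_t) (S : porderType d) (zero : S)
    (add : Monoid.com_law zero) (hS : is_Cu_semigroup add)
    (T : submonoid add) :
  is_sub_Cu_semigroup T <-> submonoid_set T = way_below_sups (submonoid_set T).
Proof.
split; first exact: sub_Cu_eq_way_below_sups.
exact: way_below_sups_eq_sub_Cu.
Qed.
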